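(* Let $n\ge2$ and let $S\subset\mathbb{R}^n$ be a nonempty locally closed subset for which there exist collections $\{L_i\}$, $\{L'_j\}$, $\{A_i\}$ forming a Khintchine system for $S$ (defined in the context). Then there exist uncountably many totally irrational $\boldsymbol{\xi}\in S$ such that $\hat{\omega}^*(\boldsymbol{\xi})=\infty$.
   Context: A set $S\subset\mathbb{R}^n$ is locally closed if there is an open set $\mathcal{W}\subset\mathbb{R}^n$ with $S=\overline{S}\cap\mathcal{W}$. Write $\|\boldsymbol{x}\|=\max_j|x_j|$, $\boldsymbol{x}\cdot\boldsymbol{y}=\sum_j x_jy_j$, and for $x\in\mathbb{R}$ let $\langle x\rangle$ be the distance from $x$ to the nearest integer. For a primitive vector $\mathbf{m}=(m_0,m_1,\ldots,m_n)\in\mathbb{Z}^{n+1}$ with $(m_1,\ldots,m_n)\neq 0$, put $A_{\mathbf{m}}=\{\boldsymbol{\xi}\in\mathbb{R}^n:\sum_{i=1}^n m_i\xi_i=m_0\}$ and $|A_{\mathbf{m}}|=\|(m_1,\ldots,m_n)\|$. The sets $A_{\mathbf{m}}$ are the rational affine hyperplanes. Khintchine system for $S$: disjoint (countable) collections $\{L_1,L_2,\ldots\}$ and $\{L'_1,L'_2,\ldots\}$ of distinct closed subsets of $S$ (closed in $S$), each contained in a rational affine hyperplane, together with, for each $i$, a rational affine hyperplane $A_i\supset L_i$, such that (closures taken in $S$): (a) $\bigcup_i L_i\cup\bigcup_j L'_j=\{\boldsymbol{x}\in S:\boldsymbol{x}\text{ is contained in a rational affine hyperplane}\}$; (b) for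 each $i$ and each $T>0$, $L_i=\overline{\bigcup_{j:\,|A_j|>T}(L_i\cap L_j)}$; (c) for each $i$ and any finite sets of indices $F,F'$ with $i\notin F$, $L_i=\overline{L_i\smallsetminus(\bigcup_{k\in F}L_k\cup\bigcup_{k'\in F'}L'_{k'})}$; (d) $\bigcup_i L_i$ is dense in $S$. A vector $\boldsymbol{\xi}\in\mathbb{R}^n$ is totally irrational if $1,\xi_1,\ldots,\xi_n$ are linearly independent over $\mathbb{Q}$. The uniform exponent in the sense of dual approximation $\hat{\omega}^*(\boldsymbol{\xi})\in[0,\infty]$ is the supremum of those $\gamma>0$ for which, for all $t$ large enough, there is $\boldsymbol{q}\in\mathbb{Z}^n$ with $\langle\boldsymbol{q}\cdot\boldsymbol{\xi}\rangle\le t^{-\gamma}$ and $0<\|\boldsymbol{q}\|\le t$. *)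

(* Defs.v *)
From HB Require Import structures.
From mathcomp Require Import all_boot all_order all_algebra.
From mathcomp Require Import all_classical all_reals all_analysis.
Set Implicit Arguments.
Unset Strict Implicit.
Unset Printing Implicit Defensive.
Import Order.TTheory GRing.Theory Num.Theory.
Import numFieldNormedType.Exports.
Local Open Scope classical_set_scope.
Local Open Scope ring_scope.

Definition locally_closed (T : topologicalType) (S : set T) : Prop :=
  exists W : set T, open W /\ S = closure S `&` W.

Definition closed_in (T : topologicalType) (S L : set T) : Prop :=
  exists C : set T, closed C /\ L = S `&` C.

Definition closure_in (T : topologicalType) (S X : set T) : set T :=
  S `&` closure X.

Definition int_norm (n : nat) (q : 'rV[int]_n) : nat :=
  (\max_(j < n) absz (q 0%R j))%N.

Definition int_dot (R : realType) (n : nat) (q : 'rV[int]_n) (x : 'rV[R]_n) : R :=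
  \sum_(j < n) (q 0 j)%:~R * x 0 j.

Definition dist_int (R : realType) (x : R) : R :=
  inf [set `|x - k%:~R| | k in [set: int]].

Definition primitive (k : nat) (m : 'rV[int]_k) : Prop :=
  \big[gcdn/0%N]_(i < k) absz (m 0 i) = 1%N.

(* The linear part (m_1, ..., m_n) of m = (m_0, m_1, ..., m_n). *)
Definition normal_part (n : nat) (m : 'rV[int]_n.+1) : 'rV[int]_n :=
  \row_(i < n) m 0 (lift ord0 i).

(* Rational affine hyperplanes are represented by their admissible coefficient
   vectors, which the hyperplane determines up to sign. *)
Definition hyperplane_coeffs (n : nat) (m : 'rV[int]_n.+1) : Prop :=
  primitive m /\ normal_part m != 0.

Definition hyperplane (R : realType) (n : nat) (m : 'rV[int]_n.+1) :
    set 'rV[R]_n :=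
  [set x | int_dot (normal_part m) x = (m 0 ord0)%:~R].
Arguments hyperplane : clear implicits.

Definition hyperplane_height (n : nat) (m : 'rV[int]_n.+1) : nat :=
  int_norm (normal_part m).

Definition in_rational_hyperplane (R : realType) (n : nat) (X : set 'rV[R]_n) :
    Prop :=
  exists m : 'rV[int]_n.+1, hyperplane_coeffs m /\ X `<=` hyperplane R n m.

(* The collections {L_i} and {L'_j} are indexed by arbitrary sets I, J of
   naturals, so each may be empty, finite or countably infinite; values of L,
   L' and A outside I, J are irrelevant.  A i is the coefficient vector of the
   hyperplane A_i. *)
Record khintchine_system (R : realType) (n : nat) (S : set 'rV[R]_n)
    (I J : set nat) (L L' : nat -> set 'rV[R]_n) (A : nat -> 'rV[int]_n.+1) :
    Prop := KhintchineSystem {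
  ks_distinct : set_inj I L ;
  ks_distinct' : set_inj J L' ;
  (* the two collections have no common member; L_i may meet L'_j *)
  ks_disjoint : (L @` I) `&` (L' @` J) = set0 ;
  ks_closed : forall i, I i -> closed_in S (L i) ;
  ks_closed' : forall j, J j -> closed_in S (L' j) ;
  ks_rational' : forall j, J j -> in_rational_hyperplane (L' j) ;
  ks_coeffs : forall i, I i -> hyperplane_coeffs (A i) ;
  ks_sub : forall i, I i -> L i `<=` hyperplane R n (A i) ;
  ks_cover : (\bigcup_(i in I) L i) `|` (\bigcup_(j in J) L' j)
    = [set x | S x /\ in_rational_hyperplane [set x]] ;
  ks_height : forall i (T : R), I i -> 0 < T ->
    L i = closure_in S
      (\bigcup_(j in [set j | I j /\ T < (hyperplane_height (A j))%:R])
         (L i `&` L j)) ;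
  ks_avoid : forall i (F F' : set nat), I i ->
    finite_set F -> finite_set F' -> F `<=` I -> F' `<=` J -> ~ F i ->
    L i = closure_in S
      (L i `\` ((\bigcup_(k in F) L k) `|` (\bigcup_(k in F') L' k))) ;
  ks_dense : S `<=` closure_in S (\bigcup_(i in I) L i)
}.

Definition totally_irrational (R : realType) (n : nat) (x : 'rV[R]_n) : Prop :=
  forall (a0 : rat) (a : 'rV[rat]_n),
    ratr a0 + \sum_(i < n) ratr (a 0 i) * x 0 i = 0 :> R -> a0 = 0 /\ a = 0.

(* 0 is added to the set so that the supremum is taken in [0, +oo]
   (ereal_sup set0 = -oo). *)
Definition dual_uniform_exponent (R : realType) (n : nat) (x : 'rV[R]_n) :
    \bar R :=
  ereal_sup ([set 0%E] `|`
    [set g%:E | g in [set g : R | 0 < g /\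
      \forall t \near +oo, exists q : 'rV[int]_n,
        [/\ dist_int (int_dot q x) <= t `^ (- g),
            (0 < int_norm q)%N & (int_norm q)%:R <= t]]]).

(* Main.v *)
Require Import Defs.
From HB Require Import structures.
From mathcomp Require Import all_boot all_order all_algebra.
From mathcomp Require Import all_classical all_reals all_analysis.
From mathcomp Require Import ring.
Import Order.TTheory GRing.Theory Num.Theory.
Import numFieldNormedType.Exports.
Local Open Scope classical_set_scope.
Local Open Scope ring_scope.
Set Implicit Arguments.
Unset Strict Implicit.
Unset Printing Implicit Defensive.

(** Why the theorem holds.  Let x lie on L_i, let q be the normal vector of A_i
    and k a natural number.  The dot product of q with any point of L_i is an
    integer.  By condition (b), arbitrarily close to x there is a point y of
    L_i lying on some L_j with |A_j| > |A_i|.  Near y the dot product with q is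
    within |A_j|^-k of that integer, so q is a good integer vector for every t
    with |A_i| <= t <= |A_j|, the error being at most t^-k.  By condition (c),
    y can be moved inside L_j, keeping this property, off any finite number of
    other members of the system; then a whole neighbourhood in S avoids these
    members, because they are closed in S.

    Iterating this move with k = 0, 1, 2, ... on shrinking nested balls gives a
    limit xi, which belongs to S because S is locally closed.  Successive
    normal vectors cover all large t, so the uniform exponent is infinite
    (dual_uniform_exponent_eqy).  The heights of the visited A_i increase, so
    an index is visited at most once; hence each L_l and each L'_l is avoided at
    some step.  By condition (a), xi lies on no rational affine hyperplane, that
    is, xi is totally irrational (totally_irrationalP).

    For uncountability, suppose that the points sought are enumerated.  They are
    totally irrational, so none of them lies on any L_j, and the k-th one can be
    excluded at step k as well: the construction then yields a point missing
    from the enumeration. *)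

(** * Nested balls *)

Lemma nbhs_closure_ball (R : realType) (T : pseudoMetricType R) (x : T)
    (U : set T) (e : R) :
  nbhs x U -> 0 < e -> exists r, [/\ 0 < r, r <= e & closure (ball x r) `<=` U].
Proof.
move=> /nbhs_ballP[d /= d0 dU] e0; exists (Num.min e (d / 2)).
rewrite lt_min e0 divr_gt0//= ge_min lexx; split=> //.
apply: subset_trans dU; apply: subset_trans (subset_closure_half d0).
by rewrite -closure_ballE; apply: closureS; apply: le_ball; rewrite ge_min lexx orbT.
Qed.

(** The step hypothesis is used infinitely often: starting from a point of
    X q, one can move within any given neighbourhood to a point of some X q'
    around which the k-th requirement C k q q' holds.  The requirement is only
    asked on a neighbourhood of the new point, which is what lets it survive all
    later moves; the closures of the successive balls are nested, with radii at
    most 1/k, so the points converge to a common point of all of them. *)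
Lemma nested_selection (R : realType) (T : completePseudoMetricType R) (Q : Type)
    (X : Q -> set T) (C : nat -> Q -> Q -> set T) (q0 : Q) (x0 : T) (W : set T) :
  X q0 x0 -> nbhs x0 W ->
  (forall k q x U, X q x -> nbhs x U ->
     exists q' x', X q' x' /\ nbhs x' (U `&` C k q q')) ->
  exists (q : nat -> Q) (xi : T),
    [/\ W xi, closure (\bigcup_k X (q k)) xi
      & forall k, C k (q k) (q k.+1) xi].
Proof.
move=> Xx0 Wx0 step.
have [r0 [r0_gt0 _ r0W]] := nbhs_closure_ball Wx0 (@ltr01 R).
(* A state is (number of moves made, (label, centre, radius)). *)
pose ok (s : nat * (Q * T * R)) := X s.2.1.1 s.2.1.2 /\ 0 < s.2.2.
pose next (s s' : {s | ok s}) :=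
  let: (k, (q, x, r)) := sval s in let: (k', (q', x', r')) := sval s' in
  [/\ k' = k.+1, r' <= k.+1%:R^-1 & closure (ball x' r') `<=` ball x r `&` C k q q'].
have nextP s : exists s', next s s'.
  case: s => -[k [[q x] r]] [/= Xqx r_gt0].
  have [q' [x' [Xx' Ux']]] := step k q x _ Xqx (nbhsx_ballx x r r_gt0).
  have kV_gt0 : 0 < k.+1%:R^-1 :> R by rewrite invr_gt0.
  have [r' [r'_gt0 r'k r'U]] := nbhs_closure_ball Ux' kV_gt0.
  have ok' : ok (k.+1, (q', x', r')) by [].
  by exists (exist _ _ ok').
have ok0 : ok (0%N, (q0, x0, r0)) by [].
have [s [s0 sS]] := dependent_choice (fun s => cid (nextP s)) (exist _ _ ok0).
pose q k := (sval (s k)).2.1.1; pose x k := (sval (s k)).2.1.2.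
pose r k := (sval (s k)).2.2.
have sk k : (sval (s k)).1 = k.
  elim: k => [|k IH]; first by rewrite s0.
  have := sS k; rewrite /next; move: IH.
  by case: (sval (s k)) (sval (s k.+1)) => [_ [[? ?] ?]] [? [[? ?] ?]] /= -> [->].
have Xx k : X (q k) (x k) by have [] := svalP (s k).
have r_gt0 k : 0 < r k by have [] := svalP (s k).
have rxS k : r k.+1 <= k.+1%:R^-1 /\
    closure (ball (x k.+1) (r k.+1)) `<=` ball (x k) (r k) `&` C k (q k) (q k.+1).
  have := sS k; have := sk k; rewrite /next /x /r /q.
  by case: (sval (s k)) (sval (s k.+1)) => [? [[? ?] ?]] [? [[? ?] ?]] /= -> [_].
have nested k m : (k <= m)%N -> ball (x m) (r m) `<=` ball (x k) (r k).
  move=> /subnK <-; elim: (m - k)%N => [//|d IH]; rewrite addSn.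
  by move=> y /subset_closure/(rxS _).2[/IH].
have xm k m : (k <= m)%N -> ball (x k) (r k) (x m).
  by move=> km; apply: nested km _ _; exact: ballxx.
have : cvg (x @ \oo).
  apply: cauchy_cvg; apply: cauchy_exP => e e_gt0.
  have [k _ /(_ k (leqnn k)) ke] := near_infty_natSinv_lt (PosNum e_gt0).
  exists (x k.+1); exists k.+1 => // m /= km.
  by apply: le_ball (xm _ _ km); apply: ltW; apply: le_lt_trans ke; exact: (rxS k).1.
move=> /cvg_ex[xi xxi]; exists q, xi.
have xi_ball k : closure (ball (x k) (r k)) xi.
  move=> U Uxi; have [m _ mU] := xxi _ Uxi.
  exists (x (maxn k m)); split; first by apply: xm; exact: leq_maxl.
  by apply: mU; exact: leq_maxr.
split.
- by apply: r0W; have := xi_ball 0%N; rewrite /x /r s0.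
- move=> U Uxi; have [m _ mU] := xxi _ Uxi.
  by exists (x m); split; [exists m | exact: mU (leqnn m)].
- by move=> k; have [] := (rxS k).2 _ (xi_ball k.+1).
Qed.

(** * Integer dot products and the uniform exponent *)

Lemma continuous_int_dot (R : realType) (n : nat) (q : 'rV[int]_n) :
  continuous (@int_dot R n q).
Proof.
move=> x; apply: (@cvg_big _ _ +%R 0 xpredT _ _ (nbhs x)) => [|j _].
  exact: add_continuous.
by apply: cvgMr; exact: coord_continuous.
Qed.

Lemma dist_int_le (R : realType) (x : R) (k : int) : dist_int x <= `|x - k%:~R|.
Proof.
apply: ge_inf; last by exists k.
by exists 0 => _ [l _ <-].
Qed.

(** The vector q k serves for all t between the norms of q k and q k.+1: as t
    does not exceed the latter, the error bound is at most t^-k, and k grows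
    with t. *)
Lemma dual_uniform_exponent_eqy (R : realType) (n : nat) (x : 'rV[R]_n)
    (q : nat -> 'rV[int]_n) :
  (forall k, (int_norm (q k) < int_norm (q k.+1))%N) ->
  (forall k, dist_int (int_dot (q k) x) <= (int_norm (q k.+1))%:R ^- k) ->
  dual_uniform_exponent x = +oo%E.
Proof.
move=> q_lt q_dist; pose H k := int_norm (q k).
have H_ge k : (k <= H k)%N.
  by elim: k => // k IH; apply: leq_ltn_trans IH (q_lt k).
apply: eq_infty => g; pose c := Num.max g 1.
have c_gt0 : 0 < c by rewrite lt_max ltr01 orbT.
apply: (@le_trans _ _ c%:E); first by rewrite lee_fin le_max lexx.
apply: ereal_sup_ubound; right; exists c => //; split=> //.
have [K cK] : exists K : nat, c <= K.+1%:R.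
  exists (Num.truncn c); apply: ltW; exact: truncnS_gt.
near=> t.
have Ht : (H K.+1)%:R <= t.
  by near: t; apply: nbhs_pinfty_ge; rewrite num_real.
have [k /andP[Kk kt] kmax] :
    {k | (K < k)%N && ((H k)%:R <= t) &
      forall l, (K < l)%N && ((H l)%:R <= t) -> (l <= k)%N}.
  have ex : exists k, (K < k)%N && ((H k)%:R <= t) by exists K.+1; rewrite leqnn.
  have bd l : (K < l)%N && ((H l)%:R <= t) -> (l <= Num.truncn t)%N.
    move=> /andP[_ lt]; apply: leq_trans (H_ge l) _.
    by rewrite -(@natrK R (H l)) le_truncn.
  by exists (ex_maxn ex bd); case: ex_maxnP.
exists (q k); split=> //; last by apply: leq_trans (H_ge k); exact: leq_ltn_trans Kk.
have tk : t < (H k.+1)%:R.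
  rewrite ltNge; apply/negP => kS; suff : (k.+1 <= k)%N by rewrite ltnn.
  by apply: kmax; rewrite kS ltnS (ltnW Kk).
have t1 : 1 <= t.
  by apply: le_trans kt; rewrite ler1n; apply: leq_trans (H_ge k); exact: leq_ltn_trans Kk.
have t_gt0 : 0 < t by exact: lt_le_trans t1.
have H_gt0 : 0 < (H k.+1)%:R :> R by exact: lt_trans tk.
apply: le_trans (q_dist k) _.
rewrite powRN lef_pV2 ?posrE ?powR_gt0 ?exprn_gt0//.
apply: (@le_trans _ _ (t `^ k%:R)).
  by apply: ler_powR => //; apply: le_trans cK _; rewrite ler_nat.
by rewrite powR_mulrn ?(ltW t_gt0)// lerXn2r ?nnegrE ?ltW.
Unshelve. all: by end_near.
Qed.

(** * Total irrationality *)

Lemma primitive_part (k : nat) (m : 'rV[int]_k) :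
  m != 0 -> exists g (m' : 'rV[int]_k), [/\ g != 0, primitive m' & m = g *: m'].
Proof.
move=> m0; pose g : nat := \big[gcdn/0%N]_(i < k) absz (m 0%R i).
have gm i : (g %| absz (m 0%R i))%N by exact: biggcdn_inf (dvdnn _).
have g_gt0 : (0 < g)%N.
  rewrite lt0n; apply: contra m0 => /eqP g0; apply/eqP/rowP => i.
  by have := gm i; rewrite g0 dvd0n absz_eq0 mxE => /eqP.
pose m' := \row_i (m 0%R i %/ g%:Z)%Z.
have mE : m = g%:Z *: m'.
  by apply/rowP => i; rewrite !mxE mulrC divzK //; exact: gm.
exists g%:Z, m'; split=> //; first by rewrite eqz_nat -lt0n.
have : (g * \big[gcdn/0%N]_(i < k) absz (m' 0%R i) = g * 1)%N.
  rewrite (big_morph (muln g) (muln_gcdr g) (muln0 g)) muln1.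
  by apply: eq_bigr => i _; rewrite [in RHS]mE [in RHS]mxE abszM.
by move/eqP; rewrite eqn_pmul2l// => /eqP.
Qed.

(** A rational relation becomes a primitive integral one after multiplication by
    a common denominator and division by the gcd.  Its linear part is nonzero
    because a relation with only the constant term is trivial. *)
Lemma totally_irrationalP (R : realType) (n : nat) (x : 'rV[R]_n) :
  totally_irrational x <-> ~ in_rational_hyperplane [set x].
Proof.
split=> [xirr [m [[_ m0] /(_ x erefl)/= xm]]|xirr a0 a].
  have [] := xirr (- m 0 ord0)%:~R (map_mx intr (normal_part m)).
    rewrite ratr_int intrN -xm /int_dot addrC; apply/eqP; rewrite subr_eq0.
    by apply/eqP/eq_bigr => i _; rewrite mxE ratr_int.
  move=> _ /rowP a0; move/negP: m0; apply; apply/eqP/rowP => i.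
  by have /eqP := a0 i; rewrite !mxE intr_eq0 => /eqP.
have [->|a_neq0] := eqVneq a 0.
  rewrite big1 ?addr0 => [/eqP|i _]; last by rewrite mxE rmorph0 mul0r.
  by rewrite fmorph_eq0 => /eqP.
move=> eq0; exfalso; apply: xirr.
pose d : int := denq a0 * \prod_(i < n) denq (a 0 i).
have [b0 b0E] : exists b : int, d%:~R * a0 = b%:~R.
  exists (numq a0 * \prod_(i < n) denq (a 0 i)).
  by rewrite /d !intrM [in LHS]mulrAC [in LHS](mulrC _ a0) -numqE.
have [b bE] : exists b : 'rV[int]_n, forall i, d%:~R * a 0 i = (b 0 i)%:~R.
  exists (\row_i (denq a0 * (numq (a 0 i) * \prod_(j < n | j != i) denq (a 0 j)))) => i.
  rewrite mxE /d (bigD1 i)//= !intrM (numqE (a 0 i)); ring.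
have d0 : d != 0.
  by rewrite mulf_neq0 ?denq_neq0//; apply/prodf_neq0 => i _; exact: denq_neq0.
pose m := \row_(i < n.+1) if unlift ord0 i is Some j then b 0 j else - b0.
have mE0 : m 0 ord0 = - b0 by rewrite mxE unlift_none.
have mES i : m 0 (lift ord0 i) = b 0 i by rewrite mxE liftK.
have b_neq0 : b != 0.
  apply: contra a_neq0 => /eqP b_eq0; apply/eqP/rowP => i; apply/eqP.
  by have /eqP := bE i; rewrite b_eq0 !mxE mulf_eq0 intr_eq0 (negPf d0).
have m_neq0 : m != 0.
  apply: contra b_neq0 => /eqP m_eq0; apply/eqP/rowP => i.
  by rewrite -mES m_eq0 !mxE.
have [g [m' [g0 m'prim m'E]]] := primitive_part m_neq0.
exists m'; split=> [|_ ->].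
  split=> //; apply: contra b_neq0 => /eqP/rowP m'_eq0; apply/eqP/rowP => i.
  by have := m'_eq0 i; rewrite -mES m'E !mxE => ->; rewrite mulr0.
have gR0 : g%:~R != 0 :> R by rewrite intr_eq0.
apply: (mulfI gR0) => /=; rewrite /int_dot mulr_sumr.
have dR (y : rat) (e c : int) :
    e%:~R * y = c%:~R -> e%:~R * ratr y = c%:~R :> R.
  by move=> ey; rewrite -(ratr_int R c) -ey rmorphM /= ratr_int.
have : (m 0 ord0)%:~R = \sum_(i < n) (m 0 (lift ord0 i))%:~R * x 0 i.
  have -> : \sum_(i < n) (m 0 (lift ord0 i))%:~R * x 0 i =
      d%:~R * \sum_(i < n) ratr (a 0 i) * x 0 i.
    by rewrite mulr_sumr; apply: eq_bigr => i _; rewrite mES -(dR _ _ _ (bE i)) !mulrA.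
  apply/eqP; rewrite mE0 intrN -(dR _ _ _ b0E) eq_sym -subr_eq0 opprK.
  by rewrite -mulrDr addrC eq0 mulr0.
rewrite m'E !mxE intrM => ->; apply: eq_bigr => i _.
by rewrite !mxE intrM mulrA.
Qed.

(** * Moves inside a Khintchine system *)

Lemma hyperplane_height_gt0 (n : nat) (m : 'rV[int]_n.+1) :
  hyperplane_coeffs m -> (0 < hyperplane_height m)%N.
Proof.
move=> [_]; apply: contraR; rewrite -leqNgt => /bigmax_leqP m0.
by apply/eqP/rowP => j; have := m0 j isT; rewrite leqn0 absz_eq0 [RHS]mxE => /eqP.
Qed.

Lemma nbhs_setC_closed_in (T : topologicalType) (S L : set T) (x : T) :
  closed_in S L -> S x -> ~ L x -> nbhs x (~` L).
Proof.
move=> [C [Ccl ->]] Sx Lx.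
have : nbhs x (~` C).
  by apply: open_nbhs_nbhs; split; [exact: closed_openC|move=> Cx; exact: Lx].
by apply: filterS => y Cy [].
Qed.

(** The requirements that the k-th move, from a point of L i to a point of L j,
    leaves for the limit point.  The index l = j cannot be excluded at this
    move, since the new point lies on L j; the next move, which leaves j,
    excludes it.  The sets Z k are a parameter through which further points are
    excluded. *)
Definition admissible_move (R : realType) (n : nat) (I J : set nat)
    (L L' : nat -> set 'rV[R]_n) (A : nat -> 'rV[int]_n.+1)
    (Z : nat -> set 'rV[R]_n) (k i j : nat) : set 'rV[R]_n :=
  [set x | [/\
    [/\ I i, I j & (hyperplane_height (A i) < hyperplane_height (A j))%N],
    `|int_dot (normal_part (A i)) x - (A i 0 ord0)%:~R|
       <= (hyperplane_height (A j))%:R ^- k,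
    ~ Z k x &
    forall l, (l <= k)%N -> (I l -> l <> j -> ~ L l x) /\ (J l -> ~ L' l x)]].

(** Two small moves are made: along L i to a point y of L j for some A j of larger
    height, by condition (b), and then along L j off the finitely many sets
    to be avoided, by condition (c).  The first makes the dot product with the
    normal vector of A i integral at y, hence nearly so around y; the second is
    chosen small enough to keep this. *)
Lemma admissible_moveP (R : realType) (n : nat) (S : set 'rV[R]_n)
    (I J : set nat) (L L' : nat -> set 'rV[R]_n) (A : nat -> 'rV[int]_n.+1)
    (Z : nat -> set 'rV[R]_n) :
  khintchine_system S I J L L' A ->
  (forall k, closed (Z k)) ->
  (forall k x, Z k x -> ~ in_rational_hyperplane [set x]) ->
  forall k i x U, I i -> L i x -> nbhs x U ->
  exists j y, [/\ I j, L j y & nbhs y (U `&` admissible_move I J L L' A Z k i j)].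
Proof.
move=> K Zcl Zirr k i x U Ii Lix xU.
have LS j y : I j -> L j y -> S y by move=> /(ks_closed K)[C [_ ->]] [].
have hi_gt0 : 0 < (hyperplane_height (A i))%:R :> R.
  by rewrite ltr0n; exact: hyperplane_height_gt0 (ks_coeffs K Ii).
(* The height of A i as threshold in (b) forces strictly larger heights. *)
have := Lix; rewrite (ks_height K Ii hi_gt0).
case=> _ /(_ _ (nbhs_interior xU))[y [[j [/= Ij ij] [Liy Ljy]] Uy]].
rewrite ltr_nat in ij.
pose e : R := (hyperplane_height (A j))%:R ^- k.
have e_gt0 : 0 < e by rewrite invr_gt0 exprn_gt0// ltr0n; exact: leq_ltn_trans ij.
have yV : \forall w \near y,
    `|int_dot (normal_part (A i)) w - (A i 0 ord0)%:~R| < e.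
  rewrite -(ks_sub K Ii Liy : int_dot _ y = _).
  have /cvgrPdist_lt/(_ e e_gt0) := @continuous_int_dot R n (normal_part (A i)) y.
  by apply: filterS => w; rewrite distrC.
pose F := [set l | (l <= k)%N /\ (I l /\ l <> j)].
pose F' := [set l | (l <= k)%N /\ J l].
have fin (P : set nat) : finite_set [set l | (l <= k)%N /\ P l].
  by apply: (@sub_finite_set _ _ `I_k.+1); [move=> l []|exact: finite_II].
have := Ljy; rewrite (ks_avoid K Ij (fin _ : finite_set F) (fin _ : finite_set F'));
  [|by move=> l [_ []]|by move=> l []|by move=> [_ []]].
case=> _ /(_ _ (filterI (nbhs_interior Uy) (nbhs_interior yV)))[z [[Ljz avoid] [Uz Vz]]].
exists j, z; split=> //; apply: filterI => //.
have Sz := LS _ _ Ij Ljz.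
have nearZ : nbhs z (~` Z k).
  apply: open_nbhs_nbhs; split; first exact: closed_openC.
  move=> /Zirr; apply; exists (A j); split; first exact: (ks_coeffs K Ij).
  by move=> _ ->; exact: (ks_sub K Ij Ljz).
pose N (l : nat) := [set w | (I l -> l <> j -> ~ L l w) /\ (J l -> ~ L' l w)].
have nearN (l : 'I_k.+1) : nbhs z (N l).
  have lk : (l <= k)%N by rewrite -ltnS.
  have avoidL : nbhs z [set w | I l -> nat_of_ord l <> j -> ~ L l w].
    case: (pselect (I l /\ nat_of_ord l <> j)) => [[Il lj]|nIl]; last first.
      by apply: (@filterE _ (nbhs z)) => w Il lj; case: nIl.
    have Llz : ~ L l z by move=> Llz; apply: avoid; left; exists (nat_of_ord l).
    move: (nbhs_setC_closed_in (ks_closed K Il) Sz Llz).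
    by apply: (@filterS _ (nbhs z)) => w Lw _ _.
  have avoidL' : nbhs z [set w | J l -> ~ L' l w].
    case: (pselect (J l)) => [Jl|nJl]; last by apply: (@filterE _ (nbhs z)) => w /nJl.
    have Llz : ~ L' l z by move=> Llz; apply: avoid; right; exists (nat_of_ord l).
    move: (nbhs_setC_closed_in (ks_closed' K Jl) Sz Llz).
    by apply: (@filterS _ (nbhs z)) => w Lw _.
  exact: (@filterI _ (nbhs z)) avoidL avoidL'.
have nearL := @filter_forall _ _ (fun l : 'I_k.+1 => N l) (nbhs z) (nbhs_filter z) nearN.
move: (Vz : nbhs z _) nearZ nearL.
apply: (@filterS3 _ (nbhs z) (nbhs_filter z)) => w Vw Zw Lw; split=> //.
  exact: ltW.
by move=> l lk; exact: (Lw (Ordinal (lk : (l < k.+1)%N))).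
Qed.

(** The sets Z k turn the existence statement into an uncountability statement:
    they may be any closed sets of totally irrational points. *)
Lemma khintchine_exists_avoiding (R : realType) (n : nat) (S : set 'rV[R]_n)
    (I J : set nat) (L L' : nat -> set 'rV[R]_n) (A : nat -> 'rV[int]_n.+1)
    (Z : nat -> set 'rV[R]_n) :
  S !=set0 -> locally_closed S -> khintchine_system S I J L L' A ->
  (forall k, closed (Z k)) ->
  (forall k x, Z k x -> ~ in_rational_hyperplane [set x]) ->
  exists x, [/\ S x, totally_irrational x, dual_uniform_exponent x = +oo%E
    & forall k, ~ Z k x].
Proof.
move=> [s Ss] [W [Wo SW]] K Zcl Zirr.
have WS x : S x -> nbhs x W.
  by rewrite SW => -[_ Wx]; exact: open_nbhs_nbhs.
have LS j y : I j -> L j y -> S y by move=> /(ks_closed K)[C [_ ->]] [].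
have [x0 [[i0 /= Ii0 Lx0] Wx0]] := (ks_dense K Ss).2 _ (WS _ Ss).
pose X i := [set x | I i /\ L i x].
have step k i x U : X i x -> nbhs x U ->
    exists j y, X j y /\ nbhs y (U `&` admissible_move I J L L' A Z k i j).
  move=> [Ii Lx] xU.
  by have [j [y [Ij Ly yU]]] := admissible_moveP K Zcl Zirr k Ii Lx xU; exists j, y.
have [a [x [Wx Xx ax]]] :=
  nested_selection (conj Ii0 Lx0 : X i0 x0) (WS _ (LS _ _ Ii0 Lx0)) step.
have Sx : S x.
  rewrite SW; split=> //; apply: closureS Xx => y [k _ [Ia Lay]]; exact: LS Ia Lay.
have a_lt k : (hyperplane_height (A (a k)) < hyperplane_height (A (a k.+1)))%N.
  by have [[]] := ax k.
exists x; split=> //; last 2 first.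
- apply: (@dual_uniform_exponent_eqy _ _ _ (fun k => normal_part (A (a k)))) => // k.
  by have [_ + _ _] := ax k; apply: le_trans; exact: dist_int_le.
- by move=> k; have [] := ax k.
apply/totally_irrationalP => xrat.
have : ((\bigcup_(i in I) L i) `|` (\bigcup_(j in J) L' j)) x.
  by rewrite (ks_cover K).
case=> -[l l_in Llx]; last by have [_ _ _ /(_ l (leqnn l))[_ /(_ l_in Llx)]] := ax l.
(* Move l excludes L l unless it arrives there; in that case, move l.+1 leaves
   L l for an index of larger height and excludes it. *)
have [al|/eqP al] := eqVneq l (a l.+1); last first.
  by have [_ _ _ /(_ l (leqnn l))[/(_ l_in al Llx)]] := ax l.
have [_ _ _ /(_ l (leqnSn l))[/(_ l_in _ Llx)+ _]] := ax l.+1; apply => lE.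
by have := a_lt l.+1; rewrite -lE -al ltnn.
Qed.

Theorem corollary1p2 (R : realType) (n : nat) (hn : (2 <= n)%N)
    (S : set 'rV[R]_n) (hS0 : S !=set0) (hS : locally_closed S)
    (hK : exists (I J : set nat) (L L' : nat -> set 'rV[R]_n)
            (A : nat -> 'rV[int]_n.+1), khintchine_system S I J L L' A) :
  ~ countable [set x : 'rV[R]_n |
      [/\ S x, totally_irrational x & dual_uniform_exponent x = +oo%E]].
Proof.
move: hK => [I [J [L [L' [A K]]]]]; set E := [set x | _].
move=> /countable_injP[f finj].
(* Each Z k has at most one point, as f is injective on E. *)
pose Z k := [set x | E x /\ f x = k].
have Zcl k : closed (Z k).
  have [->|/set0P[z [Ez fz]]] := eqVneq (Z k) set0; first exact: closed0.
  rewrite (_ : Z k = [set z]); last first.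
    apply/seteqP; split=> [y [Ey fy]|y ->]; last by split.
    by apply: finj; rewrite ?inE// fy fz.
  apply: accessible_closed_set1; apply: hausdorff_accessible.
  exact: norm_hausdorff.
have [x [Sx xirr xoo /(_ (f x))]] := khintchine_exists_avoiding hS0 hS K Zcl
  (fun k x '(conj (And3 _ xirr _) _) => (totally_irrationalP x).1 xirr).
by apply.
Qed.
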